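(* Let $\mathcal C$ be a closed additive monoidal category as in the context. Let $A$ and $B$ be self-induced algebras in $\mathcal C$ and let $M$ be a smooth $A,B$-bimodule. Then the functors $$\mathfrak{Mod}_B\to\mathfrak{Mod}_A,\quad X\mapsto M\otimes_B X,\qquad\text{and}\qquad \mathfrak{Mod}_A\to\mathfrak{Mod}_B,\quad Y\mapsto \mathrm S_B\bigl(\underline{\mathrm{Hom}}_A(M,Y)\bigr),$$ are adjoint to each other, that is, there is a natural isomorphism $$\mathcal C_A(M\otimes_B X,Y)\cong\mathcal C_B\bigl(X,\mathrm S_B(\underline{\mathrm{Hom}}_A(M,Y))\bigr)$$ for every smooth left $B$-module $X$ and every smooth left $A$-module $Y$.
   Context: Setting: $\mathcal C$ is an additive monoidal category (additive, with additive tensor bifunctor $\otimes$ and tensor unit $\mathbf 1$; associators are suppressed) that is (left) closed: for each object $A$ the functor $B\mapsto A\otimes B$ has a right adjoint $C\mapsto \underline{\mathrm{Hom}}(A,C)$, so $\mathcal C(A\otimes B,C)\cong\mathcal C(B,\underline{\mathrm{Hom}}(A,C))$ naturally, with evaluation maps $A\otimes\underline{\mathrm{Hom}}(A,B)\to B$. All morphisms in $\mathcal C$ have kernels and cokernels, and $\otimes$ commutes with cokernels in both variables. Algebras and modules: An algebra in $\mathcal C$ is an object $A$ with an associative multiplication $\mu\colon A\otimes A\to A$ (no unit required). A left $A$-module is an object $X$ with $\mu_X\colon A\otimes X\to X$ satisfying $\mu_X\circ(A\otimes\mu_X)=\mu_X\circ(\mu\otimes X)$ (no unit condition). Right modules are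 defined similarly; an $A,B$-bimodule has commuting left $A$- and right $B$-module structures. $\mathcal C_A(X,Y)$ denotes the left $A$-module homomorphisms $X\to Y$. Balanced tensor product and Hom: For a right $A$-module $X$ and a left $A$-module $Y$, $X\otimes_A Y$ is the cokernel of $\mu_X\otimes Y-X\otimes\mu_Y\colon X\otimes A\otimes Y\to X\otimes Y$. For left $A$-modules $X,Y$, $\underline{\mathrm{Hom}}_A(X,Y)$ is the kernel of the map $\underline{\mathrm{Hom}}(X,Y)\to\underline{\mathrm{Hom}}(A\otimes X,Y)$, $f\mapsto f\circ\mu_X-\mu_Y\circ(A\otimes f)$ (interpreted via the internal composition and inflation maps). If $M$ is an $A,B$-bimodule, then $M\otimes_B X$ is a left $A$-module via the left action on $M$, and for a left $A$-module $Y$, $\underline{\mathrm{Hom}}_A(M,Y)$ is a left $B$-module via the right action on $M$ (informally $(b\cdot f)(m)=f(m\cdot b)$). Self-induced, smooth: The algebra $A$ is self-induced if the map $\bar\mu\colon A\otimes_AA\to A$ induced by $\mu$ is an isomorphism. For self-induced $A$, a left $A$-module $X$ is smooth if the map $\bar\mu_X\colon A\otimes_AX\to X$ induced by $\mu_X$ is an isomorphism; a right $A$-module $X$ is smooth if the map $X\otimes_AA\to X$ induced by multiplication is an isomorphism. An $A,B$-bimodule is smooth if it is smooth as a left $A$-module and as a right $B$-module. $\mathfrak{Mod}_A$ is the category of smooth left $A$-modules (full subcategory of all left $A$-modules). The smoothening functor of $B$ is $\mathrm S_B(X)=B\otimes_BX$ for any left $B$-module $X$; it takes values in smooth modules. 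*)

(* Defs.v *)
From HB Require Import structures.
From mathcomp Require Import all_boot all_algebra.

Set Implicit Arguments.
Unset Strict Implicit.
Unset Printing Implicit Defensive.

Import GRing.Theory.
Local Open Scope ring_scope.

Declare Scope cat_scope.
Delimit Scope cat_scope with cat.
Local Open Scope cat_scope.

Reserved Notation "g ∘ f" (at level 40, left associativity).
Reserved Notation "X ⊗ Y" (at level 35, right associativity).
Reserved Notation "f ⊗₁ g" (at level 35, right associativity).

(* Categories enriched over abelian groups, with morphisms compared by
   Leibniz equality. *)
Record preadditive_category := PreadditiveCategory {
  obj :> Type;
  hom : obj -> obj -> zmodType;
  idm : forall X, hom X X;
  comp : forall X Y Z, hom Y Z -> hom X Y -> hom X Z;
  compA : forall W X Y Z (h : hom Y Z) (g : hom X Y) (f : hom W X),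
    comp h (comp g f) = comp (comp h g) f;
  comp1m : forall X Y (f : hom X Y), comp (idm Y) f = f;
  compm1 : forall X Y (f : hom X Y), comp f (idm X) = f;
  compDl : forall X Y Z (g g' : hom Y Z) (f : hom X Y),
    comp (g + g') f = comp g f + comp g' f;
  compDr : forall X Y Z (g : hom Y Z) (f f' : hom X Y),
    comp g (f + f') = comp g f + comp g f'
}.
Arguments hom {p}.
Arguments idm {p}.
Arguments comp {p X Y Z}.

Notation "g ∘ f" := (comp g f) : cat_scope.

Section Morphisms.
Variable C : preadditive_category.

Definition is_iso (X Y : C) (f : hom X Y) : Prop :=
  exists g : hom Y X, g ∘ f = idm X /\ f ∘ g = idm Y.

Definition is_kernel (K X Y : C) (f : hom X Y) (k : hom K X) : Prop :=
  f ∘ k = 0 /\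
  forall (W : C) (g : hom W X), f ∘ g = 0 -> exists! h : hom W K, k ∘ h = g.

Definition is_cokernel (X Y Q : C) (f : hom X Y) (q : hom Y Q) : Prop :=
  q ∘ f = 0 /\
  forall (Z : C) (g : hom Y Z), g ∘ f = 0 -> exists! h : hom Q Z, h ∘ q = g.

Definition is_zero (Z : C) : Prop :=
  forall X : C, (forall f : hom X Z, f = 0) /\ (forall f : hom Z X, f = 0).

Definition is_biproduct (X Y P : C) (i1 : hom X P) (i2 : hom Y P)
    (p1 : hom P X) (p2 : hom P Y) : Prop :=
  [/\ p1 ∘ i1 = idm X, p2 ∘ i2 = idm Y, p1 ∘ i2 = 0, p2 ∘ i1 = 0
    & i1 ∘ p1 + i2 ∘ p2 = idm P].

Lemma comp0m (X Y Z : C) (f : hom X Y) : (0 : hom Y Z) ∘ f = 0.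
Proof. by apply: (addrI (0 ∘ f)); rewrite -compDl !addr0. Qed.

Lemma compm0 (X Y Z : C) (g : hom Y Z) : g ∘ (0 : hom X Y) = 0.
Proof. by apply: (addrI (g ∘ 0)); rewrite -compDr !addr0. Qed.

Lemma compNl (X Y Z : C) (g : hom Y Z) (f : hom X Y) : (- g) ∘ f = - (g ∘ f).
Proof. by apply: (addrI (g ∘ f)); rewrite -compDl !subrr comp0m. Qed.

Lemma compNr (X Y Z : C) (g : hom Y Z) (f : hom X Y) : g ∘ (- f) = - (g ∘ f).
Proof. by apply: (addrI (g ∘ f)); rewrite -compDr !subrr compm0. Qed.

Lemma compBl (X Y Z : C) (g g' : hom Y Z) (f : hom X Y) :
  (g - g') ∘ f = g ∘ f - g' ∘ f.
Proof. by rewrite compDl compNl. Qed.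

Lemma compBr (X Y Z : C) (g : hom Y Z) (f f' : hom X Y) :
  g ∘ (f - f') = g ∘ f - g ∘ f'.
Proof. by rewrite compDr compNr. Qed.

Section Lift.
Variables (K X Y : C) (f : hom X Y) (k : hom K X).
Hypothesis kerk : is_kernel f k.

Lemma ker_lift_ex W (g : hom W X) : f ∘ g = 0 -> exists h : hom W K, k ∘ h == g.
Proof. by case/kerk.2 => h [/eqP hP _]; exists h. Qed.

Definition ker_lift W (g : hom W X) (gf : f ∘ g = 0) : hom W K :=
  xchoose (ker_lift_ex gf).

Lemma ker_liftK W (g : hom W X) (gf : f ∘ g = 0) : k ∘ ker_lift gf = g.
Proof. exact: (eqP (xchooseP (ker_lift_ex gf))). Qed.

Lemma ker_mono W (h h' : hom W K) : k ∘ h = k ∘ h' -> h = h'.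
Proof.
move=> e; have fkh : f ∘ (k ∘ h) = 0 by rewrite compA kerk.1 comp0m.
by have [u [_ uP]] := kerk.2 _ _ fkh; rewrite -(uP h erefl) -(uP h' (esym e)).
Qed.

End Lift.

Section Desc.
Variables (X Y Q : C) (f : hom X Y) (q : hom Y Q).
Hypothesis cokq : is_cokernel f q.

Lemma coker_desc_ex Z (g : hom Y Z) :
  g ∘ f = 0 -> exists h : hom Q Z, h ∘ q == g.
Proof. by case/cokq.2 => h [/eqP hP _]; exists h. Qed.

Definition coker_desc Z (g : hom Y Z) (gf : g ∘ f = 0) : hom Q Z :=
  xchoose (coker_desc_ex gf).

Lemma coker_descK Z (g : hom Y Z) (gf : g ∘ f = 0) : coker_desc gf ∘ q = g.
Proof. exact: (eqP (xchooseP (coker_desc_ex gf))). Qed.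

Lemma coker_epi Z (h h' : hom Q Z) : h ∘ q = h' ∘ q -> h = h'.
Proof.
move=> e; have hqf : (h ∘ q) ∘ f = 0 by rewrite -compA cokq.1 compm0.
by have [u [_ uP]] := cokq.2 _ _ hqf; rewrite -(uP h erefl) -(uP h' (esym e)).
Qed.

End Desc.
End Morphisms.

Record functor (C D : preadditive_category) := Functor {
  fobj :> C -> D;
  fmap : forall X Y : C, hom X Y -> hom (fobj X) (fobj Y);
  fmap1 : forall X : C, fmap (idm X) = idm (fobj X);
  fmapM : forall (X Y Z : C) (g : hom Y Z) (f : hom X Y),
    fmap (g ∘ f) = fmap g ∘ fmap f;
  fmapD : forall (X Y : C) (f g : hom X Y), fmap (f + g) = fmap f + fmap g
}.
Arguments fmap {C D} f0 {X Y}.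

Section FunctorComposition.
Variables (C D E : preadditive_category) (G : functor D E) (F : functor C D).

Lemma functor_comp1 (X : C) : fmap G (fmap F (idm X)) = idm (G (F X)).
Proof. by rewrite !fmap1. Qed.

Lemma functor_compM (X Y Z : C) (g : hom Y Z) (f : hom X Y) :
  fmap G (fmap F (g ∘ f)) = fmap G (fmap F g) ∘ fmap G (fmap F f).
Proof. by rewrite !fmapM. Qed.

Lemma functor_compD (X Y : C) (f g : hom X Y) :
  fmap G (fmap F (f + g)) = fmap G (fmap F f) + fmap G (fmap F g).
Proof. by rewrite !fmapD. Qed.

Definition functor_comp : functor C E :=
  Functor functor_comp1 functor_compM functor_compD.

End FunctorComposition.

(* F is left adjoint to G. *)
Record adjunction (C D : preadditive_category)
    (F : functor C D) (G : functor D C) := Adjunction {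
  adj : forall (X : C) (Y : D), hom (F X) Y -> hom X (G Y);
  adjV : forall (X : C) (Y : D), hom X (G Y) -> hom (F X) Y;
  adjK : forall X Y, cancel (@adj X Y) (@adjV X Y);
  adjVK : forall X Y, cancel (@adjV X Y) (@adj X Y);
  adj_natural : forall (X X' : C) (Y Y' : D)
      (u : hom X' X) (f : hom (F X) Y) (v : hom Y Y'),
    adj (v ∘ f ∘ fmap F u) = fmap G v ∘ adj f ∘ u
}.
Arguments adj {C D F G} a {X Y}.
Arguments adjV {C D F G} a {X Y}.

Definition adjoint (C D : preadditive_category)
    (F : functor C D) (G : functor D C) : Prop :=
  inhabited (adjunction F G).

Section FullSubcategory.
Variables (C : preadditive_category) (P : C -> Prop).

Definition full_subcategory : preadditive_category :=
  @PreadditiveCategory {X : C | P X} (fun X Y => hom (sval X) (sval Y))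
    (fun X => idm (sval X)) (fun X Y Z => @comp C (sval X) (sval Y) (sval Z))
    (fun W X Y Z => @compA C (sval W) (sval X) (sval Y) (sval Z))
    (fun X Y => @comp1m C (sval X) (sval Y))
    (fun X Y => @compm1 C (sval X) (sval Y))
    (fun X Y Z => @compDl C (sval X) (sval Y) (sval Z))
    (fun X Y Z => @compDr C (sval X) (sval Y) (sval Z)).

Definition full_inclusion : functor full_subcategory C :=
  @Functor full_subcategory C (fun X => sval X) (fun X Y f => f)
    (fun X => erefl) (fun X Y Z g f => erefl) (fun X Y f g => erefl).

Definition full_corestriction (D : preadditive_category) (F : functor D C)
    (FP : forall X, P (F X)) : functor D full_subcategory :=
  @Functor D full_subcategory (fun X => exist P (F X) (FP X))
    (fun X Y => @fmap D C F X Y) (@fmap1 D C F) (@fmapM D C F) (@fmapD D C F).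

End FullSubcategory.

Record additive_category := AdditiveCategory {
  add_cat :> preadditive_category;
  zero_ex : exists Z : add_cat, is_zero Z;
  biproduct_ex : forall X Y : add_cat, exists (P : add_cat)
    (i1 : hom X P) (i2 : hom Y P) (p1 : hom P X) (p2 : hom P Y),
    is_biproduct i1 i2 p1 p2
}.

Record additive_monoidal_category := AdditiveMonoidalCategory {
  mon_cat :> additive_category;
  tens : mon_cat -> mon_cat -> mon_cat;
  tensm : forall X X' Y Y' : mon_cat,
    hom X X' -> hom Y Y' -> hom (tens X Y) (tens X' Y');
  tensm1 : forall X Y : mon_cat, tensm (idm X) (idm Y) = idm (tens X Y);
  tensmM : forall (X X' X'' Y Y' Y'' : mon_cat)
      (g : hom X' X'') (f : hom X X') (g' : hom Y' Y'') (f' : hom Y Y'),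
    tensm (g ∘ f) (g' ∘ f') = tensm g g' ∘ tensm f f';
  tensmDl : forall (X X' Y Y' : mon_cat) (f f' : hom X X') (g : hom Y Y'),
    tensm (f + f') g = tensm f g + tensm f' g;
  tensmDr : forall (X X' Y Y' : mon_cat) (f : hom X X') (g g' : hom Y Y'),
    tensm f (g + g') = tensm f g + tensm f g';
  tunit : mon_cat;
  assoc : forall X Y Z : mon_cat,
    hom (tens (tens X Y) Z) (tens X (tens Y Z));
  assocV : forall X Y Z : mon_cat,
    hom (tens X (tens Y Z)) (tens (tens X Y) Z);
  assocK : forall X Y Z : mon_cat, assocV X Y Z ∘ assoc X Y Z = idm _;
  assocVK : forall X Y Z : mon_cat, assoc X Y Z ∘ assocV X Y Z = idm _;
  assoc_natural : forall (X X' Y Y' Z Z' : mon_cat)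
      (f : hom X X') (g : hom Y Y') (h : hom Z Z'),
    assoc X' Y' Z' ∘ tensm (tensm f g) h = tensm f (tensm g h) ∘ assoc X Y Z;
  lunit : forall X : mon_cat, hom (tens tunit X) X;
  lunit_iso : forall X : mon_cat, is_iso (lunit X);
  lunit_natural : forall (X Y : mon_cat) (f : hom X Y),
    lunit Y ∘ tensm (idm tunit) f = f ∘ lunit X;
  runit : forall X : mon_cat, hom (tens X tunit) X;
  runit_iso : forall X : mon_cat, is_iso (runit X);
  runit_natural : forall (X Y : mon_cat) (f : hom X Y),
    runit Y ∘ tensm f (idm tunit) = f ∘ runit X;
  pentagon : forall W X Y Z : mon_cat,
    assoc W X (tens Y Z) ∘ assoc (tens W X) Y Z =
    tensm (idm W) (assoc X Y Z) ∘ assoc W (tens X Y) Z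
      ∘ tensm (assoc W X Y) (idm Z);
  triangle : forall X Y : mon_cat,
    tensm (idm X) (lunit Y) ∘ assoc X tunit Y = tensm (runit X) (idm Y)
}.
Arguments tens {a}.
Arguments tensm {a X X' Y Y'}.
Arguments tunit {a}.
Arguments assoc {a}.
Arguments assocV {a}.
Arguments lunit {a}.
Arguments runit {a}.

Notation "X ⊗ Y" := (tens X Y) : cat_scope.
Notation "f ⊗₁ g" := (tensm f g) : cat_scope.

Section TensorLeft.
Variables (C : additive_monoidal_category) (A : C).

Lemma tens_leftM (X Y Z : C) (g : hom Y Z) (f : hom X Y) :
  idm A ⊗₁ (g ∘ f) = (idm A ⊗₁ g) ∘ (idm A ⊗₁ f).
Proof. by rewrite -tensmM comp1m. Qed.

Definition tens_left : functor C C :=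
  @Functor C C (tens A) (fun X Y f => idm A ⊗₁ f)
    (tensm1 A) tens_leftM (fun X Y => tensmDr (idm A)).

End TensorLeft.

(* Additive monoidal, closed on the left, with all kernels and cokernels (with
   chosen representatives), and ⊗ preserving cokernels in each variable. *)
Record closed_monoidal_category := ClosedMonoidalCategory {
  cl_cat :> additive_monoidal_category;
  ihom : cl_cat -> functor cl_cat cl_cat;
  ihom_adj : forall A : cl_cat, adjunction (tens_left A) (ihom A);
  ker : forall X Y : cl_cat, hom X Y -> cl_cat;
  ker_map : forall (X Y : cl_cat) (f : hom X Y), hom (ker f) X;
  ker_mapP : forall (X Y : cl_cat) (f : hom X Y), is_kernel f (ker_map f);
  coker : forall X Y : cl_cat, hom X Y -> cl_cat;
  coker_map : forall (X Y : cl_cat) (f : hom X Y), hom Y (coker f);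
  coker_mapP : forall (X Y : cl_cat) (f : hom X Y),
    is_cokernel f (coker_map f);
  tens_coker_l : forall (X Y Q W : cl_cat) (f : hom X Y) (q : hom Y Q),
    is_cokernel f q -> is_cokernel (f ⊗₁ idm W) (q ⊗₁ idm W);
  tens_coker_r : forall (X Y Q W : cl_cat) (f : hom X Y) (q : hom Y Q),
    is_cokernel f q -> is_cokernel (idm W ⊗₁ f) (idm W ⊗₁ q)
}.
Arguments ihom {c}.
Arguments ihom_adj {c}.
Arguments ker {c X Y}.
Arguments ker_map {c X Y}.
Arguments coker {c X Y}.
Arguments coker_map {c X Y}.

Section InternalHom.
Variable C : closed_monoidal_category.
Implicit Types A X Y Z W : C.

Definition curry X W Y (f : hom (X ⊗ W) Y) : hom W (ihom X Y) :=
  adj (ihom_adj X) f.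

Definition ev X Y : hom (X ⊗ ihom X Y) Y :=
  adjV (ihom_adj X) (idm (ihom X Y)).
Arguments ev : clear implicits.

(* f |-> f ∘ h *)
Definition ihom_pre X X' Y (h : hom X' X) : hom (ihom X Y) (ihom X' Y) :=
  curry (ev X Y ∘ (h ⊗₁ idm (ihom X Y))).

(* f |-> h ∘ f *)
Definition ihom_post X Y Y' (h : hom Y Y') : hom (ihom X Y) (ihom X Y') :=
  fmap (ihom X) h.

(* f |-> A ⊗ f *)
Definition ihom_inflate A X Y : hom (ihom X Y) (ihom (A ⊗ X) (A ⊗ Y)) :=
  curry ((idm A ⊗₁ ev X Y) ∘ assoc A X (ihom X Y)).

End InternalHom.
Arguments ev {C}.
Arguments ihom_inflate {C}.

(* Algebras and modules are not required to be unital. *)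
Record algebra (C : closed_monoidal_category) := Algebra {
  alg_obj :> C;
  mul : hom (alg_obj ⊗ alg_obj) alg_obj;
  mul_assoc : mul ∘ (mul ⊗₁ idm alg_obj) =
              mul ∘ (idm alg_obj ⊗₁ mul) ∘ assoc _ _ _
}.
Arguments mul {C}.

Record lmodule (C : closed_monoidal_category) (A : algebra C) := LModule {
  lmod_obj :> C;
  lact : hom (A ⊗ lmod_obj) lmod_obj;
  lact_assoc : lact ∘ (mul A ⊗₁ idm lmod_obj) =
               lact ∘ (idm A ⊗₁ lact) ∘ assoc _ _ _
}.
Arguments lact {C A}.

Record rmodule (C : closed_monoidal_category) (A : algebra C) := RModule {
  rmod_obj :> C;
  ract : hom (rmod_obj ⊗ A) rmod_obj;
  ract_assoc : ract ∘ (ract ⊗₁ idm A) =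
               ract ∘ (idm rmod_obj ⊗₁ mul A) ∘ assoc _ _ _
}.
Arguments ract {C A}.

Record bimodule (C : closed_monoidal_category) (A B : algebra C) := Bimodule {
  bi_left :> lmodule A;
  bi_ract : hom (bi_left ⊗ B) bi_left;
  bi_ract_assoc : bi_ract ∘ (bi_ract ⊗₁ idm B) =
                  bi_ract ∘ (idm bi_left ⊗₁ mul B) ∘ assoc _ _ _;
  bi_comm : bi_ract ∘ (lact bi_left ⊗₁ idm B) =
            lact bi_left ∘ (idm A ⊗₁ bi_ract) ∘ assoc _ _ _
}.
Arguments bi_ract {C A B}.

Definition bi_right (C : closed_monoidal_category) (A B : algebra C)
  (M : bimodule A B) : rmodule B := RModule (bi_ract_assoc M).

Section RegularModules.
Variables (C : closed_monoidal_category) (A : algebra C).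

Definition regular_lmodule : lmodule A := LModule (mul_assoc A).
Definition regular_rmodule : rmodule A := RModule (mul_assoc A).
Definition regular_bimodule : bimodule A A :=
  @Bimodule C A A regular_lmodule (mul A) (mul_assoc A) (mul_assoc A).

End RegularModules.

Section ModuleHom.
Variables (C : closed_monoidal_category) (A : algebra C).

Definition is_lmodule_hom (X Y : lmodule A) : pred (hom X Y) :=
  fun f => f ∘ lact X == lact Y ∘ (idm A ⊗₁ f).

Lemma is_lmodule_hom_zmod (X Y : lmodule A) :
  zmod_closed (@is_lmodule_hom X Y).
Proof.
have tD : {morph (fun f : hom X Y => idm A ⊗₁ f) : f g / f + g}.
  by move=> f g; rewrite tensmDr.
have t0 : idm A ⊗₁ (0 : hom X Y) = 0.
  by apply: (addrI (idm A ⊗₁ 0)); rewrite -tensmDr !addr0.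
split=> [|f g]; first by rewrite /in_mem /= /is_lmodule_hom t0 comp0m compm0.
rewrite /in_mem /= /is_lmodule_hom => /eqP fP /eqP gP.
have -> : idm A ⊗₁ (f - g) = idm A ⊗₁ f - idm A ⊗₁ g.
  by apply/(canRL (addrK _)); rewrite -tensmDr subrK.
by rewrite compBl compBr fP gP.
Qed.

HB.instance Definition _ (X Y : lmodule A) :=
  GRing.isZmodClosed.Build (hom X Y) (@is_lmodule_hom X Y)
    (is_lmodule_hom_zmod X Y).

Record lmodule_hom (X Y : lmodule A) := LModuleHom {
  lmh_val :> hom X Y;
  lmh_valP : is_lmodule_hom lmh_val
}.

HB.instance Definition _ (X Y : lmodule A) := [isSub for @lmh_val X Y].
HB.instance Definition _ (X Y : lmodule A) :=
  [Choice of lmodule_hom X Y by <:].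
HB.instance Definition _ (X Y : lmodule A) :=
  [SubChoice_isSubZmodule of lmodule_hom X Y by <:].

Lemma lmh_comm (X Y : lmodule A) (f : lmodule_hom X Y) :
  f ∘ lact X = lact Y ∘ (idm A ⊗₁ f).
Proof. exact/eqP/lmh_valP. Qed.

Lemma lmh_inj (X Y : lmodule A) (f g : lmodule_hom X Y) :
  lmh_val f = lmh_val g -> f = g.
Proof. exact: val_inj. Qed.

Lemma lmh_valD (X Y : lmodule A) (f g : lmodule_hom X Y) :
  lmh_val (f + g) = lmh_val f + lmh_val g.
Proof. by []. Qed.

Lemma lmh_id_subproof (X : lmodule A) : is_lmodule_hom (idm X : hom X X).
Proof. by rewrite /is_lmodule_hom tensm1 comp1m compm1. Qed.

Lemma lmh_comp_subproof (X Y Z : lmodule A)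
    (g : lmodule_hom Y Z) (f : lmodule_hom X Y) : is_lmodule_hom (g ∘ f).
Proof.
apply/eqP; rewrite -compA lmh_comm compA lmh_comm -compA.
by rewrite -tensmM comp1m.
Qed.

Definition lmh_id (X : lmodule A) := LModuleHom (lmh_id_subproof X).
Definition lmh_comp (X Y Z : lmodule A)
    (g : lmodule_hom Y Z) (f : lmodule_hom X Y) :=
  LModuleHom (lmh_comp_subproof g f).

Lemma lmh_compA (W X Y Z : lmodule A)
    (h : lmodule_hom Y Z) (g : lmodule_hom X Y) (f : lmodule_hom W X) :
  lmh_comp h (lmh_comp g f) = lmh_comp (lmh_comp h g) f.
Proof. by apply: lmh_inj; rewrite /= compA. Qed.

Lemma lmh_comp1m (X Y : lmodule A) (f : lmodule_hom X Y) :
  lmh_comp (lmh_id Y) f = f.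
Proof. by apply: lmh_inj; rewrite /= comp1m. Qed.

Lemma lmh_compm1 (X Y : lmodule A) (f : lmodule_hom X Y) :
  lmh_comp f (lmh_id X) = f.
Proof. by apply: lmh_inj; rewrite /= compm1. Qed.

Lemma lmh_compDl (X Y Z : lmodule A)
    (g g' : lmodule_hom Y Z) (f : lmodule_hom X Y) :
  lmh_comp (g + g') f = lmh_comp g f + lmh_comp g' f.
Proof. by apply: lmh_inj; exact: compDl. Qed.

Lemma lmh_compDr (X Y Z : lmodule A)
    (g : lmodule_hom Y Z) (f f' : lmodule_hom X Y) :
  lmh_comp g (f + f') = lmh_comp g f + lmh_comp g f'.
Proof. by apply: lmh_inj; exact: compDr. Qed.

Definition LMod : preadditive_category :=
  @PreadditiveCategory (lmodule A) (fun X Y => lmodule_hom X Y)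
    lmh_id lmh_comp lmh_compA lmh_comp1m lmh_compm1 lmh_compDl lmh_compDr.

End ModuleHom.
Arguments LMod {C}.

Section BalancedTensor.
Variables (C : closed_monoidal_category) (A : algebra C).

Definition balancing (X : rmodule A) (Y : lmodule A) :
    hom ((X ⊗ A) ⊗ Y) (X ⊗ Y) :=
  ract X ⊗₁ idm Y - (idm X ⊗₁ lact Y) ∘ assoc X A Y.

Definition btens (X : rmodule A) (Y : lmodule A) : C := coker (balancing X Y).

Definition btens_proj (X : rmodule A) (Y : lmodule A) :
  hom (X ⊗ Y) (btens X Y) := coker_map (balancing X Y).

Lemma btens_projP (X : rmodule A) (Y : lmodule A) :
  is_cokernel (balancing X Y) (btens_proj X Y).
Proof. exact: coker_mapP. Qed.

Lemma balancing_natural (R : rmodule A) (X Y : lmodule A) (f : hom X Y) :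
  f ∘ lact X = lact Y ∘ (idm A ⊗₁ f) ->
  (idm R ⊗₁ f) ∘ balancing R X = balancing R Y ∘ (idm (R ⊗ A) ⊗₁ f).
Proof.
move=> fP; rewrite compBr compBl -!tensmM !comp1m !compm1; congr (_ - _).
rewrite compA -tensmM comp1m fP -[idm R in LHS]comp1m tensmM -!compA.
by rewrite -tensm1 assoc_natural.
Qed.

Lemma lact_balanced (X : lmodule A) :
  lact X ∘ balancing (regular_rmodule A) X = 0.
Proof. by rewrite compBr lact_assoc compA subrr. Qed.

Lemma ract_balanced (X : rmodule A) :
  ract X ∘ balancing X (regular_lmodule A) = 0.
Proof. by rewrite compBr ract_assoc compA subrr. Qed.

Definition lact_bar (X : lmodule A) : hom (btens (regular_rmodule A) X) X :=
  coker_desc (btens_projP _ _) (lact_balanced X).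

Definition ract_bar (X : rmodule A) : hom (btens X (regular_lmodule A)) X :=
  coker_desc (btens_projP _ _) (ract_balanced X).

Definition self_induced : Prop := is_iso (lact_bar (regular_lmodule A)).

Definition lsmooth (X : lmodule A) : Prop := is_iso (lact_bar X).

Definition rsmooth (X : rmodule A) : Prop := is_iso (ract_bar X).

Definition SMod : preadditive_category :=
  @full_subcategory (LMod A) lsmooth.

Lemma lsmooth_coker (X : lmodule A) :
  lsmooth X <-> is_cokernel (balancing (regular_rmodule A) X) (lact X).
Proof.
have bq := coker_descK (btens_projP _ _) (lact_balanced X).
have qP := btens_projP (regular_rmodule A) X.
rewrite -/(lact_bar X) in bq; split.
  case=> g [gb bg]; split=> [|Z f fd]; first exact: lact_balanced.
  exists (coker_desc qP fd ∘ g); split=> [|h hP].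
    by rewrite -bq compA -(compA _ g) gb compm1 coker_descK.
  have -> : coker_desc qP fd = h ∘ lact_bar X.
    by apply: (coker_epi qP); rewrite coker_descK -compA bq hP.
  by rewrite -compA bg compm1.
move=> lP; exists (coker_desc lP qP.1); split.
  by apply: (coker_epi qP); rewrite -compA bq coker_descK comp1m.
by apply: (coker_epi lP); rewrite -compA coker_descK bq comp1m.
Qed.

End BalancedTensor.
Arguments SMod {C}.

Definition bsmooth (C : closed_monoidal_category) (A B : algebra C)
    (M : bimodule A B) : Prop :=
  lsmooth (bi_left M) /\ rsmooth (bi_right M).

Section TensorCalculus.
Variable C : closed_monoidal_category.
Implicit Types W X Y Z : C.

Lemma tensm_ml X X' Y Y' Z (f : hom X X') (g : hom Y Y') (h : hom Y' Z) :
  (idm X' ⊗₁ h) ∘ (f ⊗₁ g) = f ⊗₁ (h ∘ g).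
Proof. by rewrite -tensmM comp1m. Qed.

Lemma tensm_mr X X' Y Y' Z (f : hom X X') (g : hom Y Y') (h : hom X' Z) :
  (h ⊗₁ idm Y') ∘ (f ⊗₁ g) = (h ∘ f) ⊗₁ g.
Proof. by rewrite -tensmM comp1m. Qed.

Lemma tensm_split X X' Y Y' (f : hom X X') (g : hom Y Y') :
  (f ⊗₁ idm Y') ∘ (idm X ⊗₁ g) = (idm X' ⊗₁ g) ∘ (f ⊗₁ idm Y).
Proof. by rewrite -!tensmM !comp1m !compm1. Qed.

Lemma tensmBl X X' Y Y' (f f' : hom X X') (g : hom Y Y') :
  (f - f') ⊗₁ g = f ⊗₁ g - f' ⊗₁ g.
Proof. by apply/(canRL (addrK _)); rewrite -tensmDl subrK. Qed.

Lemma tensmBr X X' Y Y' (f : hom X X') (g g' : hom Y Y') :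
  f ⊗₁ (g - g') = f ⊗₁ g - f ⊗₁ g'.
Proof. by apply/(canRL (addrK _)); rewrite -tensmDr subrK. Qed.

Lemma tensm0r X X' Y Y' (f : hom X X') : f ⊗₁ (0 : hom Y Y') = 0.
Proof. by rewrite -(subrr 0) tensmBr subrr. Qed.

Lemma assocV_natural X X' Y Y' Z Z'
    (f : hom X X') (g : hom Y Y') (h : hom Z Z') :
  assocV X' Y' Z' ∘ (f ⊗₁ (g ⊗₁ h)) = ((f ⊗₁ g) ⊗₁ h) ∘ assocV X Y Z.
Proof.
rewrite -[LHS]compm1 -assocVK !compA; congr (_ ∘ _).
by rewrite -(compA _ _ (assoc _ _ _)) -assoc_natural compA assocK comp1m.
Qed.

Lemma pentagonV W X Y Z :
  assocV (W ⊗ X) Y Z ∘ assocV W X (Y ⊗ Z) =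
  (assocV W X Y ⊗₁ idm Z) ∘ assocV W (X ⊗ Y) Z ∘ (idm W ⊗₁ assocV X Y Z).
Proof.
have e1 : (assoc W X (Y ⊗ Z) ∘ assoc (W ⊗ X) Y Z)
    ∘ (assocV (W ⊗ X) Y Z ∘ assocV W X (Y ⊗ Z)) = idm _.
  by rewrite -compA (compA (assoc _ _ _) (assocV _ _ _)) assocVK comp1m assocVK.
have e2 : ((assocV W X Y ⊗₁ idm Z) ∘ assocV W (X ⊗ Y) Z
      ∘ (idm W ⊗₁ assocV X Y Z))
    ∘ (assoc W X (Y ⊗ Z) ∘ assoc (W ⊗ X) Y Z) = idm _.
  rewrite pentagon -!compA (compA (idm W ⊗₁ assocV _ _ _)) tensm_ml assocK.
  rewrite tensm1 comp1m (compA (assocV _ _ _)) assocK comp1m.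
  by rewrite tensm_mr assocK tensm1.
by rewrite -[LHS]comp1m -e2 -(compA _ (_ ∘ _) (_ ∘ _)) e1 compm1.
Qed.

Lemma assoc_pentagon W X Y Z :
  assoc (W ⊗ X) Y Z ∘ (assocV W X Y ⊗₁ idm Z) ∘ assocV W (X ⊗ Y) Z =
  assocV W X (Y ⊗ Z) ∘ (idm W ⊗₁ assoc X Y Z).
Proof.
have := pentagonV W X Y Z => e.
have /(congr1 (fun f => f ∘ (idm W ⊗₁ assoc X Y Z))) := e.
rewrite -[in RHS]compA tensm_ml assocK tensm1 compm1 => {}e.
by rewrite -compA -e !compA assocVK comp1m.
Qed.

Lemma curryK X W Y (f : hom (X ⊗ W) Y) :
  ev X Y ∘ (idm X ⊗₁ curry f) = f.
Proof.
rewrite /ev /curry; set F := ihom_adj X.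
apply: (can_inj (@adjK _ _ _ _ F W Y)).
have := adj_natural F (adj F f) (adjV F (idm (ihom X Y))) (idm Y).
by rewrite /= comp1m adjVK fmap1 !comp1m.
Qed.

Lemma curry_inj X W Y (g g' : hom W (ihom X Y)) :
  ev X Y ∘ (idm X ⊗₁ g) = ev X Y ∘ (idm X ⊗₁ g') -> g = g'.
Proof.
suff H (h : hom W (ihom X Y)) : adj (ihom_adj X) (ev X Y ∘ (idm X ⊗₁ h)) = h.
  by move=> e; rewrite -(H g) -(H g') e.
have := adj_natural (ihom_adj X) h (ev X Y) (idm Y).
by rewrite /= comp1m /ev adjVK fmap1 !comp1m.
Qed.

Lemma ev_post X Y Y' (h : hom Y Y') :
  ev X Y' ∘ (idm X ⊗₁ ihom_post X h) = h ∘ ev X Y.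
Proof.
apply: (can_inj (@adjK _ _ _ _ (ihom_adj X) (ihom X Y) Y')).
have e1 := adj_natural (ihom_adj X) (ihom_post X h) (ev X Y') (idm Y').
have e2 := adj_natural (ihom_adj X) (idm (ihom X Y)) (ev X Y) h.
rewrite /= comp1m fmap1 comp1m /ev adjVK comp1m in e1.
rewrite /= tensm1 !compm1 /ev adjVK compm1 in e2.
by rewrite /ev e1 e2.
Qed.

Lemma coker_iso X X' Y Y' Q (f : hom X Y) (f' : hom X' Y')
    (u : hom X' X) (v : hom Y' Y) (q : hom Y Q) :
  is_iso u -> is_iso v -> f ∘ u = v ∘ f' ->
  is_cokernel f q -> is_cokernel f' (q ∘ v).
Proof.
move=> [u' [u'u uu']] [v' [v'v vv']] e qP; split=> [|Z g gf'].
  by rewrite -compA -e compA qP.1 comp0m.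
have gf : g ∘ v' ∘ f = 0.
  rewrite -[_ ∘ f]compm1 -uu' (compA _ u) -(compA _ f) e compA -(compA g).
  by rewrite v'v compm1 gf' comp0m.
exists (coker_desc qP gf); split=> [|h hP].
  by rewrite compA coker_descK -compA v'v compm1.
by apply: (coker_epi qP); rewrite coker_descK -hP -!compA vv' compm1.
Qed.

End TensorCalculus.

Section TensorModule.
Variables (C : closed_monoidal_category) (A : algebra C).
Implicit Types (M X Y Z : lmodule A) (W V : C).

Lemma linM X Y Z (g : hom Y Z) (f : hom X Y) :
  is_lmodule_hom g -> is_lmodule_hom f -> is_lmodule_hom (X := X) (Y := Z) (g ∘ f).
Proof.
by move=> gP fP; apply: (lmh_comp_subproof (LModuleHom gP) (LModuleHom fP)).
Qed.

Lemma linB X Y (f g : hom X Y) :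
  is_lmodule_hom f -> is_lmodule_hom g -> is_lmodule_hom (X := X) (Y := Y) (f - g).
Proof. by move=> fP gP; apply: (is_lmodule_hom_zmod X Y).2. Qed.

Definition tens_lact M W : hom (A ⊗ (M ⊗ W)) (M ⊗ W) :=
  (lact M ⊗₁ idm W) ∘ assocV A M W.

Lemma tens_lact_assoc M W :
  tens_lact M W ∘ (mul A ⊗₁ idm (M ⊗ W)) =
  tens_lact M W ∘ (idm A ⊗₁ tens_lact M W) ∘ assoc A A (M ⊗ W).
Proof.
have e : tens_lact M W ∘ (mul A ⊗₁ idm (M ⊗ W)) ∘ assocV A A (M ⊗ W) =
         tens_lact M W ∘ (idm A ⊗₁ tens_lact M W).
  rewrite /tens_lact tens_leftM -tensm1 -!(compA (lact M ⊗₁ _)).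
  rewrite (compA (assocV A M W) (idm A ⊗₁ _)) !assocV_natural.
  rewrite -(compA _ (assocV _ _ _)) pentagonV !compA !tensm_mr.
  by rewrite lact_assoc -(compA _ (assoc _ _ _)) assocVK compm1.
by rewrite -e -compA assocK compm1.
Qed.

Definition tens_lmodule M W : lmodule A := LModule (tens_lact_assoc M W).

Lemma lin_tens_l M X W (f : hom M X) : is_lmodule_hom f ->
  is_lmodule_hom (X := tens_lmodule M W) (Y := tens_lmodule X W) (f ⊗₁ idm W).
Proof.
move/eqP=> fP; apply/eqP; rewrite /= /tens_lact compA tensm_mr fP.
by rewrite -compA assocV_natural compA tensm_mr.
Qed.

Lemma lin_tens_r M W V (f : hom W V) :
  is_lmodule_hom (X := tens_lmodule M W) (Y := tens_lmodule M V) (idm M ⊗₁ f).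
Proof.
apply/eqP; rewrite /= /tens_lact -compA assocV_natural !compA.
by rewrite tensm1 tensm_split.
Qed.

Lemma lin_assoc M W V :
  is_lmodule_hom (X := tens_lmodule (tens_lmodule M W) V)
    (Y := tens_lmodule M (W ⊗ V)) (assoc M W V).
Proof.
apply/eqP; rewrite /= /tens_lact -tensm_mr !compA assoc_natural tensm1.
by rewrite -!compA; congr (_ ∘ _); rewrite compA assoc_pentagon.
Qed.

Lemma lin_iso X Y (f : hom X Y) (g : hom Y X) :
  g ∘ f = idm X -> f ∘ g = idm Y -> is_lmodule_hom f -> is_lmodule_hom g.
Proof.
move=> gf fg /eqP fP; apply/eqP.
rewrite -[RHS]comp1m -gf -!compA (compA f) fP -!compA; congr (_ ∘ _).
by rewrite tensm_ml fg tensm1 compm1.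
Qed.

Lemma lin_assocV M W V :
  is_lmodule_hom (X := tens_lmodule M (W ⊗ V))
    (Y := tens_lmodule (tens_lmodule M W) V) (assocV M W V).
Proof. exact: (@lin_iso (tens_lmodule (tens_lmodule M W) V) (tens_lmodule M (W ⊗ V))
  _ _ (assocK M W V) (assocVK M W V) (lin_assoc M W V)). Qed.

Lemma lin_ract (B : algebra C) (M : bimodule A B) :
  is_lmodule_hom (X := tens_lmodule M B) (Y := M) (bi_ract M).
Proof.
apply/eqP; rewrite /= /tens_lact compA bi_comm.
by rewrite -compA assocVK compm1.
Qed.

Lemma lsmooth_tens M W : lsmooth M -> lsmooth (tens_lmodule M W).
Proof.
move=> /lsmooth_coker MP; apply/lsmooth_coker.
apply: (coker_iso (u := assocV (A ⊗ A) M W) _ _ _ (tens_coker_l W MP)).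
- by exists (assoc _ _ _); rewrite assocK assocVK.
- by exists (assoc _ _ _); rewrite assocK assocVK.
rewrite /balancing tensmBl compBl compBr -assocV_natural tensm1.
congr (_ - _); rewrite /= /tens_lact tens_leftM.
rewrite !compA assocV_natural -tensm_mr -!compA; congr (_ ∘ _).
rewrite -[LHS]compm1 -(assocK A A (M ⊗ W)) !compA; congr (_ ∘ _).
by rewrite -compA pentagonV !compA tensm_mr assocVK tensm1 comp1m.
Qed.

(* A cokernel of a module homomorphism carries a unique compatible action. *)
Section Cokernel.
Variables (X Y : lmodule A) (Q : C) (f : hom X Y) (q : hom Y Q).
Hypotheses (fP : is_lmodule_hom f) (qP : is_cokernel f q).

Lemma coker_lact_subproof : q ∘ lact Y ∘ (idm A ⊗₁ f) = 0.
Proof. by rewrite -compA -(eqP fP) compA qP.1 comp0m. Qed.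

Definition coker_lact : hom (A ⊗ Q) Q :=
  coker_desc (tens_coker_r A qP) coker_lact_subproof.

Lemma coker_lactK : coker_lact ∘ (idm A ⊗₁ q) = q ∘ lact Y.
Proof. exact: coker_descK. Qed.

Lemma coker_lact_assoc :
  coker_lact ∘ (mul A ⊗₁ idm Q) =
  coker_lact ∘ (idm A ⊗₁ coker_lact) ∘ assoc A A Q.
Proof.
apply: (coker_epi (tens_coker_r (A ⊗ A) qP)).
rewrite -compA tensm_split compA coker_lactK -!compA lact_assoc.
rewrite -[in RHS]tensm1 assoc_natural (compA (idm A ⊗₁ _)) tensm_ml.
by rewrite coker_lactK tens_leftM !compA coker_lactK.
Qed.

Definition coker_lmodule : lmodule A := LModule coker_lact_assoc.

Lemma lin_coker : is_lmodule_hom (X := Y) (Y := coker_lmodule) q.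
Proof. by apply/eqP; rewrite /= coker_lactK. Qed.

Lemma lin_coker_desc (Z : lmodule A) (h : hom Q Z) :
  is_lmodule_hom (X := Y) (Y := Z) (h ∘ q) ->
  is_lmodule_hom (X := coker_lmodule) (Y := Z) h.
Proof.
move=> /eqP hP; apply/eqP; apply: (coker_epi (tens_coker_r A qP)).
by rewrite /= -compA coker_lactK compA hP -compA tensm_ml.
Qed.

Lemma lsmooth_coker_lmodule : lsmooth X -> lsmooth Y -> lsmooth coker_lmodule.
Proof.
move=> /lsmooth_coker XP /lsmooth_coker YP; apply/lsmooth_coker.
split=> [|Z g gb]; first exact: lact_balanced.
have nb := balancing_natural (regular_rmodule A) (eqP lin_coker).
have gqb : g ∘ (idm A ⊗₁ q) ∘ balancing (regular_rmodule A) Y = 0.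
  by rewrite -compA nb compA gb comp0m.
have hf : coker_desc YP gqb ∘ f = 0.
  apply: (coker_epi XP); rewrite comp0m -compA (eqP fP) compA coker_descK.
  by rewrite -compA -tens_leftM qP.1 tensm0r compm0.
exists (coker_desc qP hf); split=> [|h' h'P].
  apply: (coker_epi (tens_coker_r A qP)).
  by rewrite -compA coker_lactK compA !coker_descK.
apply: (coker_epi qP); rewrite coker_descK; apply: (coker_epi YP).
by rewrite coker_descK -h'P -!compA coker_lactK.
Qed.

End Cokernel.
End TensorModule.

Section TensorFunctor.
Variables (C : closed_monoidal_category) (A B : algebra C) (M : bimodule A B).
Implicit Types X Y Z : lmodule B.

Local Notation q X := (btens_proj (bi_right M) X).

Lemma lin_balancing X :
  is_lmodule_hom (X := tens_lmodule (tens_lmodule M B) X)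
    (Y := tens_lmodule M X) (balancing (bi_right M) X).
Proof.
apply: linB; first exact: lin_tens_l (lin_ract M).
apply: (linM (Y := tens_lmodule M (B ⊗ X))); first exact: lin_tens_r.
exact: lin_assoc.
Qed.

(* M ⊗_B X with the left action induced by the one on M *)
Definition btens_lmodule X : lmodule A :=
  coker_lmodule (lin_balancing X) (btens_projP (bi_right M) X).

Lemma lin_btens_proj X :
  is_lmodule_hom (X := tens_lmodule M X) (Y := btens_lmodule X) (q X).
Proof. exact: lin_coker. Qed.

Lemma btens_map_subproof X Y (f : lmodule_hom X Y) :
  q Y ∘ (idm M ⊗₁ f) ∘ balancing (bi_right M) X = 0.
Proof.
rewrite -compA (balancing_natural (bi_right M) (lmh_comm f)) compA.
by rewrite (btens_projP (bi_right M) Y).1 comp0m.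
Qed.

Definition btens_map X Y (f : lmodule_hom X Y) :
    hom (btens (bi_right M) X) (btens (bi_right M) Y) :=
  coker_desc (btens_projP _ _) (btens_map_subproof f).

Lemma btens_mapK X Y (f : lmodule_hom X Y) :
  btens_map f ∘ q X = q Y ∘ (idm M ⊗₁ f).
Proof. exact: coker_descK. Qed.

Lemma lin_btens_map X Y (f : lmodule_hom X Y) :
  is_lmodule_hom (X := btens_lmodule X) (Y := btens_lmodule Y) (btens_map f).
Proof.
apply: lin_coker_desc; rewrite btens_mapK.
apply: (linM (Y := tens_lmodule M Y)); first exact: lin_btens_proj.
exact: lin_tens_r.
Qed.

Definition btens_hom X Y (f : lmodule_hom X Y) :
    lmodule_hom (btens_lmodule X) (btens_lmodule Y) :=
  LModuleHom (lin_btens_map f).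

Lemma btens_hom1 X : btens_hom (lmh_id X) = lmh_id (btens_lmodule X).
Proof.
apply: lmh_inj; apply: (coker_epi (btens_projP (bi_right M) X)).
by rewrite /= btens_mapK tensm1 comp1m compm1.
Qed.

Lemma btens_homM X Y Z (g : lmodule_hom Y Z) (f : lmodule_hom X Y) :
  btens_hom (lmh_comp g f) = lmh_comp (btens_hom g) (btens_hom f).
Proof.
apply: lmh_inj; apply: (coker_epi (btens_projP (bi_right M) X)).
rewrite /= btens_mapK tens_leftM -compA btens_mapK.
by rewrite !compA btens_mapK.
Qed.

Lemma btens_homD X Y (f g : lmodule_hom X Y) :
  btens_hom (f + g) = btens_hom f + btens_hom g.
Proof.
apply: lmh_inj; apply: (coker_epi (btens_projP (bi_right M) X)).
by rewrite /= btens_mapK tensmDr compDr compDl !btens_mapK.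
Qed.

(* X |-> M ⊗_B X on all B-modules *)
Definition btens_functor : functor (LMod B) (LMod A) :=
  @Functor (LMod B) (LMod A) btens_lmodule btens_hom
    btens_hom1 btens_homM btens_homD.

Lemma btens_lsmooth X : lsmooth (bi_left M) -> lsmooth (btens_lmodule X).
Proof.
move=> MP; rewrite /btens_lmodule; apply lsmooth_coker_lmodule.
  by do 2!apply lsmooth_tens.
by apply lsmooth_tens.
Qed.

End TensorFunctor.

Definition smoothening (C : closed_monoidal_category) (B : algebra C) :
  functor (LMod B) (LMod B) := btens_functor (regular_bimodule B).

Section InternalModuleHom.
Variables (C : closed_monoidal_category) (A : algebra C).
Implicit Types (X Y : lmodule A) (W : C).

(* f |-> f ∘ lact X - lact Y ∘ (A ⊗ f) *)
Definition lhom_diff X Y : hom (ihom X Y) (ihom (A ⊗ X) Y) :=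
  ihom_pre Y (lact X) - ihom_post (A ⊗ X) (lact Y) ∘ ihom_inflate A X Y.

Definition lhom X Y : C := ker (lhom_diff X Y).

Definition lev X Y : hom (X ⊗ lhom X Y) Y :=
  ev X Y ∘ (idm X ⊗₁ ker_map (lhom_diff X Y)).

Lemma lhom_diff_lin X Y W (g : hom W (ihom X Y)) :
  lhom_diff X Y ∘ g = 0 <->
  is_lmodule_hom (X := tens_lmodule X W) (Y := Y) (ev X Y ∘ (idm X ⊗₁ g)).
Proof.
set G := ev X Y ∘ _.
have e : ev (A ⊗ X) Y ∘ (idm (A ⊗ X) ⊗₁ (lhom_diff X Y ∘ g)) =
    G ∘ (lact X ⊗₁ idm W) - lact Y ∘ (idm A ⊗₁ G) ∘ assoc A X W.
  rewrite compBl tensmBr compBr; congr (_ - _).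
    rewrite tens_leftM compA curryK /G -!compA; congr (_ ∘ _).
    by rewrite tensm_split.
  rewrite !tens_leftM !compA ev_post -(compA (lact Y)) curryK.
  by rewrite /G -!compA -tensm1 assoc_natural !compA.
split=> [d0|/eqP GP].
  apply/eqP; rewrite /= /tens_lact compA.
  move: e; rewrite d0 tensm0r compm0 => /esym/eqP; rewrite subr_eq0 => /eqP ->.
  by rewrite -compA assocVK compm1.
apply: curry_inj; rewrite e tensm0r compm0; apply/eqP; rewrite subr_eq0.
by rewrite -GP /= /tens_lact -!compA assocK compm1.
Qed.

Lemma lhom_lift_subproof X Y W (f : hom (X ⊗ W) Y) :
  is_lmodule_hom (X := tens_lmodule X W) (Y := Y) f ->
  lhom_diff X Y ∘ curry f = 0.
Proof. by move=> fP; apply/lhom_diff_lin; rewrite curryK. Qed.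

Definition lhom_lift X Y W (f : hom (X ⊗ W) Y)
    (fP : is_lmodule_hom (X := tens_lmodule X W) (Y := Y) f) :
    hom W (lhom X Y) :=
  ker_lift (ker_mapP _) (lhom_lift_subproof fP).

Lemma lhom_liftK X Y W (f : hom (X ⊗ W) Y)
    (fP : is_lmodule_hom (X := tens_lmodule X W) (Y := Y) f) :
  lev X Y ∘ (idm X ⊗₁ lhom_lift fP) = f.
Proof. by rewrite /lev -compA tensm_ml ker_liftK curryK. Qed.

Lemma lhom_inj X Y W (g g' : hom W (lhom X Y)) :
  lev X Y ∘ (idm X ⊗₁ g) = lev X Y ∘ (idm X ⊗₁ g') -> g = g'.
Proof.
rewrite /lev -!compA !tensm_ml => /curry_inj.
exact: (ker_mono (ker_mapP _)).
Qed.

Lemma lin_lev X Y :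
  is_lmodule_hom (X := tens_lmodule X (lhom X Y)) (Y := Y) (lev X Y).
Proof. by apply/lhom_diff_lin; case: (ker_mapP (lhom_diff X Y)). Qed.

End InternalModuleHom.

Section HomFunctor.
Variables (C : closed_monoidal_category) (A B : algebra C) (M : bimodule A B).
Implicit Types X Y Z : lmodule A.

Lemma lhom_lact_subproof Y :
  is_lmodule_hom (X := tens_lmodule M (B ⊗ lhom M Y)) (Y := Y)
    (lev M Y ∘ (bi_ract M ⊗₁ idm (lhom M Y)) ∘ assocV M B (lhom M Y)).
Proof.
apply: (linM (Y := tens_lmodule (tens_lmodule M B) (lhom M Y))).
  apply: (linM (Y := tens_lmodule M (lhom M Y))); first exact: lin_lev.
  exact: lin_tens_l (lin_ract M).
exact: lin_assocV.
Qed.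

(* (b . f)(m) = f(m . b) *)
Definition lhom_lact Y : hom (B ⊗ lhom M Y) (lhom M Y) :=
  lhom_lift (lhom_lact_subproof Y).

Lemma lhom_lactK Y :
  lev M Y ∘ (idm M ⊗₁ lhom_lact Y) =
  lev M Y ∘ (bi_ract M ⊗₁ idm (lhom M Y)) ∘ assocV M B (lhom M Y).
Proof. exact: lhom_liftK. Qed.

Lemma lhom_lact_assoc Y :
  lhom_lact Y ∘ (mul B ⊗₁ idm (lhom M Y)) =
  lhom_lact Y ∘ (idm B ⊗₁ lhom_lact Y) ∘ assoc B B (lhom M Y).
Proof.
apply: lhom_inj; set K := lhom M Y.
have e : lev M Y ∘ (idm M ⊗₁ lhom_lact Y) ∘
    (idm M ⊗₁ (mul B ⊗₁ idm K)) =
    lev M Y ∘ ((bi_ract M ∘ (bi_ract M ⊗₁ idm B) ∘ assocV M B B) ⊗₁ idm K)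
      ∘ assocV M (B ⊗ B) K.
  rewrite lhom_lactK -!compA assocV_natural (compA (_ ⊗₁ _) (_ ⊗₁ _)).
  rewrite tensm_mr (compA (bi_ract M)) bi_ract_assoc.
  by rewrite -(compA _ (assoc _ _ _)) assocVK compm1.
have e' : lev M Y ∘ (idm M ⊗₁ lhom_lact Y) ∘
    (idm M ⊗₁ (idm B ⊗₁ lhom_lact Y)) =
    lev M Y ∘ ((bi_ract M ∘ (bi_ract M ⊗₁ idm B)) ⊗₁ idm K)
      ∘ (assocV (M ⊗ B) B K ∘ assocV M B (B ⊗ K)).
  rewrite lhom_lactK -!compA assocV_natural tensm1 (compA (_ ⊗₁ _) (_ ⊗₁ _)).
  rewrite tensm_split !compA lhom_lactK -!compA; congr (_ ∘ _).
  rewrite -(tensm_mr (bi_ract M ⊗₁ idm B)) -!compA.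
  by rewrite (compA (assocV _ _ _)) -(tensm1 B) assocV_natural -!compA.
rewrite !tens_leftM !compA e e' pentagonV -!compA tensm_ml assocK tensm1 compm1.
by rewrite (compA (_ ⊗₁ _) (assocV _ _ _ ⊗₁ _)) tensm_mr !compA.
Qed.

Definition lhom_lmodule Y : lmodule B := LModule (lhom_lact_assoc Y).

Lemma lhom_map_subproof X Y (f : lmodule_hom X Y) :
  is_lmodule_hom (X := tens_lmodule M (lhom M X)) (Y := Y) (f ∘ lev M X).
Proof. by apply: (linM (Y := X)); [exact: lmh_valP | exact: lin_lev]. Qed.

Definition lhom_map X Y (f : lmodule_hom X Y) : hom (lhom M X) (lhom M Y) :=
  lhom_lift (lhom_map_subproof f).

Lemma lhom_mapK X Y (f : lmodule_hom X Y) :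
  lev M Y ∘ (idm M ⊗₁ lhom_map f) = f ∘ lev M X.
Proof. exact: lhom_liftK. Qed.

Lemma lin_lhom_map X Y (f : lmodule_hom X Y) :
  is_lmodule_hom (X := lhom_lmodule X) (Y := lhom_lmodule Y) (lhom_map f).
Proof.
apply/eqP; apply: lhom_inj; rewrite /= !tens_leftM !compA lhom_mapK lhom_lactK.
rewrite -(compA _ (lev _ _)) lhom_lactK -(compA _ (assocV _ _ _)) assocV_natural.
rewrite tensm1 [RHS]compA -(compA _ (bi_ract M ⊗₁ _) (idm _ ⊗₁ _)) tensm_split !compA.
by rewrite lhom_mapK !compA.
Qed.

Definition lhom_hom X Y (f : lmodule_hom X Y) :
    lmodule_hom (lhom_lmodule X) (lhom_lmodule Y) :=
  LModuleHom (lin_lhom_map f).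

Lemma lhom_hom1 X : lhom_hom (lmh_id X) = lmh_id (lhom_lmodule X).
Proof.
by apply: lmh_inj; apply: lhom_inj; rewrite /= lhom_mapK tensm1 comp1m compm1.
Qed.

Lemma lhom_homM X Y Z (g : lmodule_hom Y Z) (f : lmodule_hom X Y) :
  lhom_hom (lmh_comp g f) = lmh_comp (lhom_hom g) (lhom_hom f).
Proof.
apply: lmh_inj; apply: lhom_inj.
by rewrite /= tens_leftM compA !lhom_mapK -(compA _ (lev _ _)) lhom_mapK compA.
Qed.

Lemma lhom_homD X Y (f g : lmodule_hom X Y) :
  lhom_hom (f + g) = lhom_hom f + lhom_hom g.
Proof.
apply: lmh_inj; apply: lhom_inj.
by rewrite /= lhom_mapK tensmDr compDr compDl !lhom_mapK.
Qed.

(* Y |-> Hom_A(M, Y) on all A-modules *)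
Definition lhom_functor : functor (LMod A) (LMod B) :=
  @Functor (LMod A) (LMod B) lhom_lmodule lhom_hom
    lhom_hom1 lhom_homM lhom_homD.

End HomFunctor.

Section SmoothFunctors.
Variables (C : closed_monoidal_category) (A B : algebra C) (M : bimodule A B).

Lemma smod_tens_subproof (MP : bsmooth M) (X : SMod B) :
  lsmooth (functor_comp (btens_functor M) (@full_inclusion _ _) X).
Proof. exact: btens_lsmooth MP.1. Qed.

(* X |-> M ⊗_B X *)
Definition smod_tens (MP : bsmooth M) : functor (SMod B) (SMod A) :=
  full_corestriction (smod_tens_subproof MP).

Lemma smod_hom_subproof (BP : self_induced B) (Y : SMod A) :
  lsmooth (functor_comp (smoothening B)
    (functor_comp (lhom_functor M) (@full_inclusion _ _)) Y).
Proof. exact: (btens_lsmooth (M := regular_bimodule B)) BP. Qed.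

(* Y |-> S_B (Hom_A(M, Y)) *)
Definition smod_hom (BP : self_induced B) : functor (SMod A) (SMod B) :=
  full_corestriction (smod_hom_subproof BP).

End SmoothFunctors.

(* Main.v *)
(* Tensor-hom adjointness already holds on arbitrary modules: both sides of
   the bijection are the A-linear, B-balanced maps from the tensor product of
   M and X to Y.  It remains to see that S_B is right adjoint to the inclusion
   of smooth modules, with counit the multiplication map t_Z : S_B Z -> Z.
   For smooth X the inverse of composition with t_Z sends f to the composite
   of S_B f with the inverse of t_X; this uses only that t is natural and that
   t_(S_B Z) = S_B (t_Z). *)
From mathcomp Require Import all_boot all_algebra.
Require Import Defs.

Set Implicit Arguments.
Unset Strict Implicit.
Unset Printing Implicit Defensive.

Import GRing.Theory.
Local Open Scope ring_scope.
Local Open Scope cat_scope.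

(** The cokernel relation with the associator moved across, since the actions on tensor products and
    on [lhom] are written with [assocV]. *)
Lemma btens_proj_balanced (C : closed_monoidal_category) (B : algebra C)
    (R : rmodule B) (X : lmodule B) :
  btens_proj R X ∘ (ract R ⊗₁ idm X) ∘ assocV R B X =
  btens_proj R X ∘ (idm R ⊗₁ lact X).
Proof.
have := (btens_projP R X).1; rewrite /balancing compBr => /eqP.
by rewrite subr_eq0 => /eqP ->; rewrite compA -compA assocVK compm1.
Qed.

Section TensorHom.
Variables (C : closed_monoidal_category) (A B : algebra C) (M : bimodule A B).
Implicit Types (X : lmodule B) (Y : lmodule A).

Local Notation q X := (btens_proj (bi_right M) X).

Lemma tens_hom_lin_subproof X Y (f : lmodule_hom (btens_lmodule M X) Y) :
  is_lmodule_hom (X := tens_lmodule M X) (Y := Y) (f ∘ q X).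
Proof. exact: linM (lmh_valP f) (lin_btens_proj M X). Qed.

(** As [b] acts on [lhom M Y] by [(b . h)(m) = h(m . b)], B-linearity of the transpose of [f ∘ q X]
    says exactly that this map is balanced. *)
Lemma lin_tens_hom X Y (f : lmodule_hom (btens_lmodule M X) Y) :
  is_lmodule_hom (X := X) (Y := lhom_lmodule M Y)
    (lhom_lift (tens_hom_lin_subproof f)).
Proof.
apply/eqP; apply: lhom_inj; rewrite /= !tens_leftM !compA lhom_lactK lhom_liftK.
rewrite -(compA _ (assocV _ _ _)) assocV_natural tensm1 compA.
rewrite -(compA _ (bi_ract M ⊗₁ _)) tensm_split compA lhom_liftK.
by rewrite -!compA; congr (_ ∘ _); rewrite -(btens_proj_balanced (bi_right M)) compA.
Qed.

Definition tens_hom X Y (f : lmodule_hom (btens_lmodule M X) Y) :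
    lmodule_hom X (lhom_lmodule M Y) := LModuleHom (lin_tens_hom f).

(** Linearity of [g] moves the balancing map from [X] to [lhom M Y], where evaluation kills it by
    the definition of [lhom_lact]. *)
Lemma hom_tens_balanced X Y (g : lmodule_hom X (lhom_lmodule M Y)) :
  lev M Y ∘ (idm M ⊗₁ g) ∘ balancing (bi_right M) X = 0.
Proof.
rewrite -compA (balancing_natural (bi_right M) (lmh_comm g)) compA.
rewrite [X in X ∘ _](_ : _ = 0) ?comp0m //.
by rewrite compBr compA lhom_lactK -(compA _ (assocV _ _ _)) assocK compm1 subrr.
Qed.

Lemma lin_hom_tens X Y (g : lmodule_hom X (lhom_lmodule M Y)) :
  is_lmodule_hom (X := btens_lmodule M X) (Y := Y)
    (coker_desc (btens_projP (bi_right M) X) (hom_tens_balanced g)).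
Proof.
apply: lin_coker_desc; rewrite coker_descK.
by apply: (linM (Y := tens_lmodule M (lhom M Y))); [exact: lin_lev | exact: lin_tens_r].
Qed.

Definition hom_tens X Y (g : lmodule_hom X (lhom_lmodule M Y)) :
    lmodule_hom (btens_lmodule M X) Y := LModuleHom (lin_hom_tens g).

Lemma tens_homK X Y : cancel (@tens_hom X Y) (@hom_tens X Y).
Proof.
move=> f; apply: lmh_inj; apply: (coker_epi (btens_projP (bi_right M) X)).
by rewrite /= coker_descK lhom_liftK.
Qed.

Lemma hom_tensK X Y : cancel (@hom_tens X Y) (@tens_hom X Y).
Proof.
by move=> g; apply: lmh_inj; apply: lhom_inj; rewrite /= lhom_liftK coker_descK.
Qed.

Lemma tens_hom_natural (X X' : LMod B) (Y Y' : LMod A) (u : hom X' X)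
    (f : hom (btens_functor M X) Y) (v : hom Y Y') :
  tens_hom (v ∘ f ∘ fmap (btens_functor M) u) =
  fmap (lhom_functor M) v ∘ (tens_hom f : hom X (lhom_functor M Y)) ∘ u.
Proof.
apply: lmh_inj; apply: lhom_inj.
rewrite lhom_liftK /= !tens_leftM !compA lhom_mapK.
rewrite -(compA _ (lev _ _)) lhom_liftK -(compA _ (btens_map M u)) btens_mapK.
by rewrite !compA.
Qed.

Definition tens_hom_adjunction : adjunction (btens_functor M) (lhom_functor M) :=
  @Adjunction (LMod B) (LMod A) (btens_functor M) (lhom_functor M)
    tens_hom hom_tens tens_homK hom_tensK tens_hom_natural.

End TensorHom.

Section Smoothening.
Variables (C : closed_monoidal_category) (B : algebra C).
Implicit Types X Z : lmodule B.

Local Notation S := (smoothening B).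
Local Notation R := (regular_bimodule B).
Local Notation q X := (btens_proj (bi_right R) X).

Lemma lact_barK Z : lact_bar Z ∘ q Z = lact Z.
Proof. exact: coker_descK. Qed.

(** Pulled back along the projection, linearity becomes associativity of the action on [Z]. *)
Lemma lin_lact_bar Z :
  is_lmodule_hom (X := btens_lmodule (regular_bimodule B) Z) (Y := Z) (lact_bar Z).
Proof.
apply: lin_coker_desc; rewrite lact_barK; apply/eqP.
by rewrite /= /tens_lact compA lact_assoc -(compA _ (assoc _ _ _)) assocVK compm1.
Qed.

Definition smooth_counit Z : hom (S Z) (Z : LMod B) := LModuleHom (lin_lact_bar Z).

Lemma smooth_counit_natural (X Z : LMod B) (f : hom X Z) :
  smooth_counit Z ∘ fmap S f = f ∘ smooth_counit X.
Proof.
apply: lmh_inj; apply: (coker_epi (btens_projP (bi_right R) X)).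
rewrite /= -[LHS]compA -[RHS]compA (btens_mapK R f).
by rewrite lact_barK [LHS]compA lact_barK -lmh_comm.
Qed.

(** On [b ⊗ (b' ⊗ z)] the left side gives the class of [bb' ⊗ z] and the right side that of
    [b ⊗ b'z]; these agree by balancing. *)
Lemma smooth_counit_S Z : smooth_counit (S Z) = fmap S (smooth_counit Z).
Proof.
apply: lmh_inj; apply: (coker_epi (btens_projP (bi_right R) (S Z))).
(* Tensoring with [B] preserves cokernels, so [B ⊗ q Z] is epi as well and both sides can be
   compared on [B ⊗ (B ⊗ Z)]. *)
apply: (coker_epi (tens_coker_r B (btens_projP (bi_right R) Z))).
rewrite /= (btens_mapK R (smooth_counit Z)) (lact_barK (S Z)).
rewrite -[RHS]compA.
rewrite -tens_leftM lact_barK -(btens_proj_balanced (bi_right R)).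
rewrite -[RHS]compA.
exact: (esym (eqP (lin_btens_proj R Z))).
Qed.

(** Smoothness gives an inverse in [C], which is linear as the inverse of a linear map. The boolean
    form lets [xchoose] extract it. *)
Lemma smooth_counit_inv_ex X : lsmooth X ->
  exists g : hom (X : LMod B) (S X),
    (g ∘ smooth_counit X == idm (S X)) && (smooth_counit X ∘ g == idm (X : LMod B)).
Proof.
case=> g [gt tg].
exists (LModuleHom (lin_iso (X := btens_lmodule R X) (Y := X) gt tg (lin_lact_bar X))).
by apply/andP; split; apply/eqP; apply: lmh_inj.
Qed.

Definition smooth_unit X (XP : lsmooth X) : hom (X : LMod B) (S X) :=
  xchoose (smooth_counit_inv_ex XP).

Lemma smooth_unitK X (XP : lsmooth X) : smooth_unit XP ∘ smooth_counit X = idm (S X).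
Proof. by have /andP[/eqP] := xchooseP (smooth_counit_inv_ex XP). Qed.

Lemma smooth_counitK X (XP : lsmooth X) :
  smooth_counit X ∘ smooth_unit XP = idm (X : LMod B).
Proof. by have /andP[_ /eqP] := xchooseP (smooth_counit_inv_ex XP). Qed.

Lemma smooth_unit_natural (X Z : LMod B) (XP : lsmooth X) (ZP : lsmooth Z)
    (f : hom X Z) :
  smooth_unit ZP ∘ f = fmap S f ∘ smooth_unit XP.
Proof.
rewrite -[LHS]compm1 -(smooth_counitK XP) !compA; congr (_ ∘ _).
by rewrite -compA -smooth_counit_natural compA smooth_unitK comp1m.
Qed.

Definition smooth_lift X (XP : lsmooth X) (Z : LMod B) (f : hom (X : LMod B) Z) :
    hom (X : LMod B) (S Z) := fmap S f ∘ smooth_unit XP.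

Lemma smooth_liftK X (XP : lsmooth X) (Z : LMod B) :
  cancel (@smooth_lift X XP Z) (fun g => smooth_counit Z ∘ g).
Proof.
move=> f; rewrite /smooth_lift compA smooth_counit_natural -compA.
by rewrite smooth_counitK compm1.
Qed.

(** Replacing [S] of the counit by the counit of [S Z] makes naturality applicable to [g] itself. *)
Lemma smooth_counit_liftK X (XP : lsmooth X) (Z : LMod B) :
  cancel (fun g => smooth_counit Z ∘ g) (@smooth_lift X XP Z).
Proof.
move=> g; rewrite /smooth_lift fmapM -smooth_counit_S smooth_counit_natural.
by rewrite -compA smooth_counitK compm1.
Qed.

Lemma smooth_lift_natural X X' (XP : lsmooth X) (XP' : lsmooth X') (Z Z' : LMod B)
    (u : hom (X' : LMod B) X) (f : hom (X : LMod B) Z) (v : hom Z Z') :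
  smooth_lift XP' (v ∘ f ∘ u) = fmap S v ∘ smooth_lift XP f ∘ u.
Proof.
by rewrite /smooth_lift !fmapM -!compA (smooth_unit_natural XP' XP).
Qed.

End Smoothening.

Theorem proposition5p3 (C : closed_monoidal_category) (A B : algebra C)
    (M : bimodule A B) (hA : self_induced A) (hB : self_induced B)
    (hM : bsmooth M) :
  adjoint (smod_tens hM) (smod_hom M hB).
Proof.
pose T := tens_hom_adjunction M.
pose phi (X : SMod B) (Y : SMod A) (f : hom (smod_tens hM X) Y) :
  hom X (smod_hom M hB Y) := smooth_lift (proj2_sig X) (adj T f).
pose psi (X : SMod B) (Y : SMod A) (g : hom X (smod_hom M hB Y)) :
  hom (smod_tens hM X) Y := adjV T (smooth_counit (lhom_lmodule M (sval Y)) ∘ g).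
constructor; apply: (@Adjunction _ _ _ _ phi psi).
- by move=> X Y f; rewrite /psi /phi smooth_liftK adjK.
- by move=> X Y g; rewrite /psi /phi adjVK smooth_counit_liftK.
move=> X X' Y Y' u f v; rewrite /phi.
(* Smooth modules form a full subcategory, so [u] and [v] are read as morphisms of arbitrary
   modules. *)
have e := adj_natural T (u : hom (sval X') (sval X)) f (v : hom (sval Y) (sval Y')).
rewrite [adj T _]e; exact: smooth_lift_natural.
Qed.
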